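(* Let $s>0$. There exists $n_0(s)\in\mathbb{N}^+$ such that for every positive integer $n>2s$ and every real $p>\frac{n}{n-2s}$ the following holds for the inequality $$p\,\frac{\Gamma\left(\frac{n}{2}-\frac{s}{p-1}\right)\Gamma\left(s+\frac{s}{p-1}\right)}{\Gamma\left(\frac{s}{p-1}\right)\Gamma\left(\frac{n-2s}{2}-\frac{s}{p-1}\right)}>\frac{\Gamma\left(\frac{n+2s}{4}\right)^2}{\Gamma\left(\frac{n-2s}{4}\right)^2}.\qquad (I)$$ (1) If $n\le n_0(s)$, then (I) holds if and only if $$p>p_1:=\frac{n+2s-2+2a_{n,s}\sqrt{n}}{n-2s-2+2a_{n,s}\sqrt{n}}.$$ (2) If $n>n_0(s)$, then (I) holds if and only if $$p_1:=\frac{n+2s-2+2a_{n,s}\sqrt{n}}{n-2s-2+2a_{n,s}\sqrt{n}}<p<p_2:=\frac{n+2s-2-2a_{n,s}\sqrt{n}}{n-2s-2-2a_{n,s}\sqrt{n}},$$ where $$\frac{n}{n-2s}<p_1<\frac{n+2s}{n-2s}<\frac{n+2s-4}{n-2s-4}<p_2<+\infty.$$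
   Context: $\Gamma$ is the Gamma function. For a positive integer $n$ and real $s$ with $0<s<n/2$, the function $f_{n,s}$ is defined for real $a$ with $-\frac12\frac{n-2s}{\sqrt n}-\frac1{\sqrt n}<a<\frac12\frac{n-2s}{\sqrt n}+\frac1{\sqrt n}$ (so that all Gamma arguments are positive) by $$f_{n,s}(a)=\ln\Gamma\left(\tfrac n4+\tfrac s2+\tfrac12+\tfrac12a\sqrt n\right)+\ln\Gamma\left(\tfrac n4+\tfrac s2+\tfrac12-\tfrac12a\sqrt n\right)-2\ln\Gamma\left(\tfrac n4+\tfrac s2\right)$$ $$\qquad-\ln\Gamma\left(\tfrac n4-\tfrac s2+\tfrac12+\tfrac12a\sqrt n\right)-\ln\Gamma\left(\tfrac n4-\tfrac s2+\tfrac12-\tfrac12a\sqrt n\right)+2\ln\Gamma\left(\tfrac n4-\tfrac s2\right).$$ The number $a_{n,s}$ is the unique positive root of $f_{n,s}$ in this domain; it satisfies $\frac{1}{\sqrt n}<a_{n,s}<\frac12\frac{n-2s}{\sqrt n}+\frac{1}{\sqrt n}$. *)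

(* Defs.v *)
From HB Require Import structures.
From mathcomp Require Import all_boot all_order all_algebra.
From mathcomp Require Import all_classical all_reals all_analysis.
Set Implicit Arguments.
Unset Strict Implicit.
Unset Printing Implicit Defensive.
Import Order.TTheory GRing.Theory Num.Theory.
Import numFieldNormedType.Exports.
Local Open Scope classical_set_scope.
Local Open Scope ring_scope.

(* Euler's integral: this is the Gamma function only for x > 0, which is the
   only range on which it is used below. *)
Definition Gamma (R : realType) (x : R) : R :=
  \int[lebesgue_measure]_(t in `]0, +oo[) (t `^ (x - 1) * expR (- t)).

Definition lnGamma (R : realType) (x : R) : R := ln (Gamma x).

Definition f_dom (R : realType) (n : nat) (s : R) : set R :=
  [set a | - (2^-1 * ((n%:R - 2 * s) / Num.sqrt n%:R)) - 1 / Num.sqrt n%:R < a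
           < 2^-1 * ((n%:R - 2 * s) / Num.sqrt n%:R) + 1 / Num.sqrt n%:R].

Definition f_ns (R : realType) (n : nat) (s a : R) : R :=
  lnGamma (n%:R / 4 + s / 2 + 1 / 2 + 1 / 2 * a * Num.sqrt n%:R)
  + lnGamma (n%:R / 4 + s / 2 + 1 / 2 - 1 / 2 * a * Num.sqrt n%:R)
  - 2 * lnGamma (n%:R / 4 + s / 2)
  - lnGamma (n%:R / 4 - s / 2 + 1 / 2 + 1 / 2 * a * Num.sqrt n%:R)
  - lnGamma (n%:R / 4 - s / 2 + 1 / 2 - 1 / 2 * a * Num.sqrt n%:R)
  + 2 * lnGamma (n%:R / 4 - s / 2).

Definition pos_root (R : realType) (n : nat) (s a : R) : Prop :=
  [/\ f_dom n s a, 0 < a & f_ns n s a = 0].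

(* The unique positive root; the default value 0 would be returned only if
   there were no positive root or more than one. *)
Definition a_ns (R : realType) (n : nat) (s : R) : R :=
  xget 0 [set a | unique (pos_root n s) a].

Definition p1 (R : realType) (n : nat) (s : R) : R :=
  (n%:R + 2 * s - 2 + 2 * a_ns n s * Num.sqrt n%:R)
  / (n%:R - 2 * s - 2 + 2 * a_ns n s * Num.sqrt n%:R).

Definition p2_den (R : realType) (n : nat) (s : R) : R :=
  n%:R - 2 * s - 2 - 2 * a_ns n s * Num.sqrt n%:R.

Definition p2 (R : realType) (n : nat) (s : R) : R :=
  (n%:R + 2 * s - 2 - 2 * a_ns n s * Num.sqrt n%:R) / p2_den n s.

Definition ineq_I (R : realType) (n : nat) (s p : R) : Prop :=
  p * (Gamma (n%:R / 2 - s / (p - 1)) * Gamma (s + s / (p - 1))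
       / (Gamma (s / (p - 1)) * Gamma ((n%:R - 2 * s) / 2 - s / (p - 1))))
  > Gamma ((n%:R + 2 * s) / 4) ^+ 2 / Gamma ((n%:R - 2 * s) / 4) ^+ 2.

(* Main.v *)
Require Import Defs.
From HB Require Import structures.
From mathcomp Require Import all_boot all_order all_algebra.
From mathcomp Require Import all_classical all_reals all_analysis.
From mathcomp Require Import measurable_realfun ring lra.
Import Order.TTheory GRing.Theory Num.Theory.
Import numFieldNormedType.Exports.
Local Open Scope classical_set_scope.
Local Open Scope ring_scope.

(** Put x = n/4 + s/2, y = n/4 - s/2, t = s/(p-1) and v = t - y + 1/2, so that
    0 < y < x and, when p runs over the admissible range, t runs over ]0, 2y[.
    As p = (s+t)/t, the functional equation of Gamma absorbs the factor p, and
    the inequality becomes F(v) > 0, where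
      F(v) = ln Gamma(x+1/2+v) + ln Gamma(x+1/2-v) - 2 ln Gamma(x)
             - (the same expression in y).
    This F is f_{n,s}(a) at v = a sqrt(n)/2; it is even, and
    F(1/2) = ln(x/y) > 0.

    The key fact is that the mixed second difference
      ln Gamma(z+d+e) - ln Gamma(z+d) - ln Gamma(z+e) + ln Gamma(z)
    decreases strictly in z > 0 ([mixed_diff_decr]). It equals the sum over k of
    ln(1 + de/((z+k)(z+k+d+e))), each term of which decreases; this uses only
    the functional equation and the log-convexity of Gamma, never the digamma
    function. It follows that F decreases strictly in |v| ([profile_decr]).
    Since Gamma has a pole at 0, F takes negative values near v = y + 1/2, so F
    has one positive root v0 = a_{n,s} sqrt(n)/2, which lies in
    ]1/2, y + 1/2[ ([profile_root]), and the inequality holds exactly when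
    |v| < v0, that is, y - 1/2 - v0 < t < y - 1/2 + v0. The upper bound on t
    reads p > p1. The lower bound is void when v0 >= y - 1/2 and otherwise
    reads p < p2.

    Which case occurs is decided by the sign of F at v = 1/2 - y, the limit
    position of v as p tends to infinity. With s fixed, that value again
    decreases strictly in y, by the key fact; it is positive at y = 1 and tends
    to -oo ([profile_infty_decr], [profile_infty1_gt0],
    [profile_infty_eventually_lt0]). It therefore changes sign once along n,
    which defines n0(s). *)

(** * Euler's integral: finiteness, functional equation, log-convexity *)

Section gamma_integral.
Context {R : realType}.
Notation mu := (@lebesgue_measure R).
Implicit Types x t : R.

Definition gamma_integrand x t : R := t `^ (x - 1) * expR (- t).

Lemma gamma_integrandE x t : 0 < t ->
  gamma_integrand x t = expR ((x - 1) * ln t - t).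
Proof. by move=> t0; rewrite /gamma_integrand /powR gt_eqF// -expRD. Qed.

Lemma gamma_integrand_ge0 x t : 0 <= gamma_integrand x t.
Proof. by rewrite mulr_ge0 ?powR_ge0 ?expR_ge0. Qed.

Lemma continuous_gamma_integrand x t : 0 < t ->
  {for t, continuous (gamma_integrand x)}.
Proof.
move=> t0.
have h1 : {for t, continuous (fun t => t `^ (x - 1))}.
  apply: differentiable_continuous; apply/derivable1_diffP.
  by apply: derivable_powR; rewrite in_itv/= t0.
have h2 : {for t, continuous (fun t => expR (- t))}.
  apply: (@continuous_comp _ _ _ -%R expR); last exact: continuous_expR.
  exact: opp_continuous.
exact: (cvgM h1 h2).
Qed.

Lemma measurable_gamma_integrand x :
  measurable_fun (`](0 : R), +oo[) (gamma_integrand x).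
Proof.
apply: open_continuous_measurable_fun => // t.
by rewrite inE/= in_itv/= andbT => /continuous_gamma_integrand; apply.
Qed.

(** The extended real integral makes sense before finiteness is known, and
    finiteness for x <= 1 comes from the functional equation. *)
Definition eGamma x : \bar R :=
  (\int[mu]_(t in `](0 : R)%R, +oo[) (gamma_integrand x t)%:E)%E.

Lemma GammaE x : Gamma x = fine (eGamma x).
Proof. by []. Qed.

Lemma eGamma_ge0 x : (0 <= eGamma x)%E.
Proof. by apply: integral_ge0 => t _; rewrite lee_fin gamma_integrand_ge0. Qed.

(** From ln u <= u at u = t / (2 x): powers of t grow slower than exp(t / 2). *)
Lemma mulr_ln_le x t : 0 < x -> 0 < t -> x * ln t <= t / 2 + x * ln (2 * x).
Proof.
move=> x0 t0; have x20 : 0 < 2 * x by rewrite mulr_gt0.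
have tx0 : 0 < t / (2 * x) by rewrite divr_gt0.
have -> : ln t = ln (t / (2 * x)) + ln (2 * x).
  by rewrite -lnM ?posrE// divfK// gt_eqF.
rewrite mulrDr lerD2r; apply: (@le_trans _ _ (x * (t / (2 * x)))).
  by rewrite ler_pM2l// ltW// ln_sublinear.
by rewrite le_eqVlt; apply/orP; left; apply/eqP; field; rewrite gt_eqF.
Qed.

Lemma gamma_integrand_le_pdf x t : 1 < x -> 0 < t ->
  gamma_integrand x t <=
  2 * expR ((x - 1) * ln (2 * (x - 1))) * exponential_pdf 2^-1 t.
Proof.
move=> x1 t0; have x0 : 0 < x - 1 by rewrite subr_gt0.
rewrite exponential_pdfE ?(ltW t0)// gamma_integrandE// mulrACA mulfV// mul1r.
rewrite -expRD ler_expR.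
have := mulr_ln_le _ _ x0 t0; lra.
Qed.

(** Domination by a multiple of the exponential density of rate 1/2; for x < 1
    the integrand is unbounded near 0. *)
Lemma eGamma_lty_gt1 x : 1 < x -> (eGamma x < +oo)%E.
Proof.
move=> x1.
pose C := 2 * expR ((x - 1) * ln (2 * (x - 1))).
have C0 : 0 <= C by rewrite mulr_ge0 ?expR_ge0.
have h0 : 0 < 2^-1 :> R by rewrite invr_gt0.
apply: (@le_lt_trans _ _
  (\int[mu]_(t in `](0 : R)%R, +oo[) (C%:E * (exponential_pdf 2^-1 t)%:E))%E).
  apply: ge0_le_integral => //=.
  - by move=> t _; rewrite lee_fin gamma_integrand_ge0.
  - by apply/measurable_EFinP; exact: measurable_gamma_integrand.
  - apply: measurable_funTS; apply/measurable_EFinP.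
    apply: measurable_funM => //.
    exact: measurable_exponential_pdf.
  - move=> t; rewrite in_itv/= andbT => t0.
    by rewrite -EFinM lee_fin gamma_integrand_le_pdf.
rewrite ge0_integralZl//=; last 2 first.
- apply: measurable_funTS; apply/measurable_EFinP.
  exact: measurable_exponential_pdf.
- by move=> t _; rewrite lee_fin exponential_pdf_ge0// ltW.
rewrite lte_mul_pinfty//.
apply: (@le_lt_trans _ _ (\int[mu]_t (exponential_pdf 2^-1 t)%:E)%E).
  apply: ge0_subset_integral => //=.
  - by apply/measurable_EFinP; exact: measurable_exponential_pdf.
  - by move=> t _; rewrite lee_fin exponential_pdf_ge0// ltW.
by rewrite integral_exponential_pdf// ltry.
Qed.

(** Integration by parts is carried out on the compact intervals [1/N, N], with
    N = n + 2 so that 1/N < N, and passed to the limit by monotone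
    convergence. *)
Let box (n : nat) : set R := `[n.+2%:R^-1, n.+2%:R].

Let box_gt0 n t : box n t -> 0 < t.
Proof.
by rewrite /box/= in_itv/= => /andP[+ _]; apply: lt_le_trans; rewrite invr_gt0.
Qed.

Let box_nd : nondecreasing_seq box.
Proof.
apply/nondecreasing_seqP => n; apply/subsetPset => t; rewrite /box/= !in_itv/=.
move=> /andP[h1 h2]; apply/andP; split.
  by apply: le_trans h1; rewrite lef_pV2 ?posrE ?ltr0n// ler_nat.
by apply: le_trans h2 _; rewrite ler_nat.
Qed.

Let bigcup_box : \bigcup_n box n = `]0, +oo[%classic.
Proof.
apply/seteqP; split => t.
  by move=> [n _ /box_gt0]; rewrite /= in_itv/= andbT.
rewrite /= in_itv/= andbT => t0.
exists (Num.truncn (Num.max t t^-1)) => //; rewrite /box/= in_itv/=.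
set m := Num.truncn _.
have : Num.max t t^-1 < m.+2%:R.
  by apply: lt_trans (truncnS_gt _) _; rewrite ltr_nat.
rewrite gt_max => /andP[h1 h2]; apply/andP; split; last exact: ltW.
by rewrite -(invrK t) lef_pV2 ?posrE ?invr_gt0// ltW.
Qed.

Let integral_box_cvg x :
  (\int[mu]_(t in box n) (gamma_integrand x t)%:E @[n --> \oo] --> eGamma x)%E.
Proof.
rewrite /eGamma -bigcup_box.
apply: ge0_nondecreasing_set_cvg_integral => //.
- by move=> i; exact: measurable_itv.
- move=> i; apply/measurable_EFinP.
  apply: measurable_funS (measurable_gamma_integrand x) => //.
  by move=> t /box_gt0; rewrite /= in_itv/= andbT.
- by move=> i t _; rewrite lee_fin gamma_integrand_ge0.
Qed.

(** The bracket of the integration by parts of t^x against exp(-t); note that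
    [gamma_integrand (x + 1) t] is t^x exp(-t). *)
Let boundary x (n : nat) : R := gamma_integrand (x + 1) n.+2%:R^-1
  - gamma_integrand (x + 1) n.+2%:R.

Let boundary_cvg x : 0 < x -> boundary x n @[n --> \oo] --> (0 : R).
Proof.
move=> x0; rewrite -[X in _ --> X](subrr 0); apply: cvgB.
  have : (n.+2%:R^-1 : R) `^ x @[n --> \oo] --> (0:R).
    have /cvg_at_rightP := @powR_cvg0 R x x0; apply; split => [n|].
      by rewrite invr_gt0.
    by have := @cvg_harmonic R; rewrite -cvg_shiftS.
  apply: squeeze_cvgr (cvg_cst 0) => //.
  near=> n; rewrite gamma_integrand_ge0/= /gamma_integrand addrK.
  by rewrite ler_piMr ?powR_ge0// -expR0 ler_expR oppr_le0.
pose C := expR (x * ln (2 * x)).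
have h : C * expR (- ((2^-1 : R) * n.+2%:R)) @[n --> \oo] --> (0:R).
  rewrite -(mulr0 C).
  have h0 : 0 < 2^-1 :> R by rewrite invr_gt0.
  have h1 : n.+2%:R @[n --> \oo] --> (+oo : set_system R).
    by have := @cvgr_idn R; rewrite -2!cvg_shiftS.
  have h3 : expR (- ((2^-1 : R) * n.+2%:R)) @[n --> \oo] --> (0:R).
    apply: (cvg_comp (fun n => (2^-1 : R) * n.+2%:R) (fun x => expR (- x)));
      last exact: cvgr_expR.
    apply: (cvg_comp (fun n => n.+2%:R) (fun x => (2^-1 : R) * x)).
      exact: h1.
    exact: (gt0_cvgMry h0 cvg_id).
  by apply: cvgM h3; exact: cvg_cst.
apply: squeeze_cvgr (cvg_cst 0) h.
near=> n; rewrite gamma_integrand_ge0/= gamma_integrandE// addrK -expRD.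
rewrite ler_expR.
have n0 : 0 < n.+2%:R :> R by rewrite ltr0n.
have := mulr_ln_le _ _ x0 n0; lra.
Unshelve. all: by end_near. Qed.

Let derive_powR x t : 0 < t ->
  ((fun t => t `^ x)^`())%classic t = x * t `^ (x - 1).
Proof. by move=> t0; rewrite derive1E; have [_ ->] := is_derive1_powR x t0. Qed.

Let integral_box_rec x n : 0 < x ->
  (\int[mu]_(t in box n) (gamma_integrand (x + 1) t)%:E =
   x%:E * \int[mu]_(t in box n) (gamma_integrand x t)%:E + (boundary x n)%:E)%E.
Proof.
move=> x0; set a : R := n.+2%:R^-1; set b : R := n.+2%:R.
have a0 : 0 < a by rewrite invr_gt0.
have ab : a < b.
  apply: (@lt_trans _ _ 1); first by rewrite invf_lt1 // ltr1n.
  by rewrite ltr1n.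
have cpow y : {within `[a, b], continuous (fun t : R => t `^ y)}.
  apply: derivable_within_continuous => t; rewrite in_itv/= => /andP[at' _].
  by apply: derivable_powR; rewrite in_itv/= (lt_le_trans a0 at').
have cexp : continuous (fun t : R => expR (- t)).
  move=> t; apply: (@continuous_comp _ _ _ -%R expR).
    exact: opp_continuous.
  exact: continuous_expR.
have cpt y t : 0 < t -> {for t, continuous (fun t : R => t `^ y)}.
  move=> t0; apply: differentiable_continuous; apply/derivable1_diffP.
  by apply: derivable_powR; rewrite in_itv/= t0.
have b0 : 0 < b by exact: lt_trans ab.
have H1 : {within `[a, b], continuous (fun t => x * t `^ (x - 1))}.
  by move=> t; apply: cvgM; [exact: cvg_cst | exact: cpow].
have H2 : derivable_oo_LRcontinuous (fun t => t `^ x) a b.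
  split.
  - move=> t; rewrite in_itv/= => /andP[at' _].
    by apply: derivable_powR; rewrite in_itv/= (lt_trans a0 at').
  - by apply: cvg_at_right_filter; exact: cpt.
  - by apply: cvg_at_left_filter; exact: cpt.
have H3 : {in `]a, b[,
    (fun t => t `^ x)^`()%classic =1 (fun t => x * t `^ (x - 1))}.
  move=> t; rewrite in_itv/= => /andP[at' _].
  by rewrite derive_powR// (lt_trans a0 at').
have H4 : {within `[a, b], continuous (fun t => expR (- t))}.
  exact: continuous_subspaceT.
have dexp t : is_derive t 1 (fun t => - expR (- t)) (expR (- t)).
  by apply: is_derive_eq; rewrite mulrN1 opprK.
have H5 : derivable_oo_LRcontinuous (fun t => - expR (- t)) a b.
  split.
  - by move=> t _; have [] := dexp t.
  - by apply: cvg_at_right_filter; apply: cvgN; exact: cexp.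
  - by apply: cvg_at_left_filter; apply: cvgN; exact: cexp.
have H6 : {in `]a, b[,
    (fun t => - expR (- t))^`()%classic =1 (fun t => expR (- t))}.
  by move=> t _; rewrite derive1E; have [_ ->] := dexp t.
have := integration_by_parts ab H1 H2 H3 H4 H5 H6.
rewrite /gamma_integrand addrK => ->.
have -> : (\int[mu]_(t in `[a, b]) (x * t `^ (x - 1) * - expR (- t))%:E =
    - (x%:E * \int[mu]_(t in `[a, b]) (gamma_integrand x t)%:E))%E.
  rewrite -ge0_integralZl//=; last 3 first.
  - apply/measurable_EFinP.
    apply: measurable_funS (measurable_gamma_integrand x) => //.
    by move=> t /box_gt0; rewrite /= in_itv/= andbT.
  - by move=> t _; rewrite lee_fin gamma_integrand_ge0.
  - by rewrite lee_fin ltW.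
  rewrite -integral_ge0N/=; last first.
    by move=> t _; rewrite lee_fin mulr_ge0 ?gamma_integrand_ge0// ltW.
  by apply: eq_integral => t _; rewrite /gamma_integrand mulrN mulrA.
rewrite oppeK addeC /boundary /gamma_integrand addrK; congr (_ + _%:E)%E.
by rewrite !mulrN opprK addrC.
Qed.

Lemma eGammaD1 x : 0 < x -> (eGamma (x + 1) = x%:E * eGamma x)%E.
Proof.
move=> x0; have h : (\int[mu]_(t in box n) (gamma_integrand (x + 1) t)%:E
    @[n --> \oo] --> x%:E * eGamma x + 0)%E.
  under eq_cvg do rewrite integral_box_rec//.
  apply: cvgeD.
  - by rewrite fin_num_adde_defl.
  - by apply: cvgeZl => //; exact: integral_box_cvg.
  - by apply: cvg_EFin; [exact: nearW | exact: boundary_cvg].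
by rewrite adde0 in h; exact: (cvg_unique _ (integral_box_cvg (x + 1)) h).
Qed.

(** Finiteness at x + 1 > 1 transfers to x, because eGamma x = +oo would force
    eGamma (x + 1) = x * +oo = +oo. *)
Lemma eGamma_fin_num x : 0 < x -> eGamma x \is a fin_num.
Proof.
move=> x0; rewrite ge0_fin_numE ?eGamma_ge0//.
have : (eGamma (x + 1) < +oo)%E by rewrite eGamma_lty_gt1// ltrDr.
rewrite eGammaD1//; case: (eGamma x) (eGamma_ge0 x) => [r _ _||]//.
  by rewrite ltry.
by rewrite gt0_muley ?lte_fin.
Qed.

Lemma integrable_gamma_integrand x : 0 < x ->
  mu.-integrable `](0 : R), +oo[ (EFin \o gamma_integrand x).
Proof.
move=> x0; apply/integrableP; split.
  by apply/measurable_EFinP; exact: measurable_gamma_integrand.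
rewrite [ltLHS](_ : _ = eGamma x).
  by rewrite -ge0_fin_numE ?eGamma_ge0// eGamma_fin_num.
by apply: eq_integral => t _; rewrite /= ger0_norm// gamma_integrand_ge0.
Qed.

Lemma GammaD1 x : 0 < x -> Gamma (x + 1) = x * Gamma x.
Proof. by move=> x0; rewrite !GammaE eGammaD1// fineM// eGamma_fin_num. Qed.

(** The integrand is bounded below by exp(-|x - 1| - 2) on [1, 2], where
    0 <= ln t <= 1. *)
Lemma Gamma_gt0 x : 0 < x -> 0 < Gamma x.
Proof.
move=> x0; rewrite GammaE -lte_fin fineK ?eGamma_fin_num//.
pose c := expR (- `|x - 1| - 2); pose J := `[1%R, 2%R]%classic : set R.
have Jge1 t : J t -> 1 <= t by rewrite /J/= in_itv/= => /andP[].
have J0 : J `<=` `]0, +oo[.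
  by move=> t /Jge1 t1; rewrite /= in_itv/= andbT (lt_le_trans ltr01).
apply: (@lt_le_trans _ _ (\int[mu]_(t in J) c%:E)%E).
  rewrite /J integral_cst//= lebesgue_measure_itv/= lte_fin ltr1n/=.
  by rewrite -EFinB -EFinM lte_fin mulr_gt0 ?expR_gt0// subr_gt0 ltr1n.
apply: (@le_trans _ _ (\int[mu]_(t in J) (gamma_integrand x t)%:E)%E).
  apply: ge0_le_integral => //=; first exact: measurable_itv.
  - by move=> t _; rewrite lee_fin expR_ge0.
  - apply/measurable_EFinP.
    exact: measurable_funS (measurable_gamma_integrand x).
  - move=> t Jt; have t1 := Jge1 _ Jt.
    have t2 : t <= 2 by move: Jt; rewrite /J/= in_itv/= => /andP[].
    have t0 : 0 < t by exact: lt_le_trans t1.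
    rewrite lee_fin gamma_integrandE// ler_expR.
    have l0 := ln_ge0 t1.
    have l1 : ln t <= 1.
      have := @le_ln1Dx R (t - 1); rewrite addrCA subrr addr0; lra.
    have := ler_norm (- (x - 1)); rewrite normrN => h.
    have h0 := normr_ge0 (x - 1).
    have : - (x - 1) * ln t <= `|x - 1| * 1.
      by apply: (le_trans (ler_wpM2r l0 h)); rewrite ler_wpM2l.
    lra.
apply: ge0_subset_integral => //=; first exact: measurable_itv.
- by apply/measurable_EFinP; exact: measurable_gamma_integrand.
- by move=> t _; rewrite lee_fin gamma_integrand_ge0.
Qed.

(** The integrand at t is the exponential of a function affine in x, so this is
    the convexity of expR between the integrands divided by A and by B; the
    normalisation will be by the values of Gamma at the end points. *)
Lemma gamma_integrand_convex (l a b A B t : R) : 0 <= l <= 1 ->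
  0 < A -> 0 < B -> 0 < t ->
  gamma_integrand ((1 - l) * a + l * b) t <=
  expR ((1 - l) * ln A + l * ln B) * (1 - l) / A * gamma_integrand a t +
  expR ((1 - l) * ln A + l * ln B) * l / B * gamma_integrand b t.
Proof.
move=> /andP[l0 l1] A0 B0 t0; rewrite !gamma_integrandE//.
set S := (1 - l) * ln A + l * ln B.
have := convex_expR (Itv01 l0 l1) ((b - 1) * ln t - t - ln B)
  ((a - 1) * ln t - t - ln A).
rewrite !convRE/= /unstable.onem addrC [leRHS]addrC.
rewrite (expRB _ (ln A)) (expRB _ (ln B)) !lnK ?posrE// => h.
have -> : ((1 - l) * a + l * b - 1) * ln t - t = S +
    ((1 - l) * ((a - 1) * ln t - t - ln A) + l * ((b - 1) * ln t - t - ln B)).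
  by rewrite /S; ring.
rewrite expRD; apply: (le_trans (ler_wpM2l (expR_ge0 S) h)).
by rewrite le_eqVlt; apply/orP; left; apply/eqP; ring.
Qed.

Lemma lnGamma_convex (l a b : R) : 0 < a -> 0 < b -> 0 <= l <= 1 ->
  lnGamma ((1 - l) * a + l * b) <= (1 - l) * lnGamma a + l * lnGamma b.
Proof.
move=> a0 b0 l01; have /andP[l0 l1] := l01.
have A0 := Gamma_gt0 _ a0; have B0 := Gamma_gt0 _ b0.
set z := (1 - l) * a + l * b.
have z0 : 0 < z.
  rewrite /z; have [->|l_neq0] := eqVneq l 0.
    by rewrite subr0 mul1r mul0r addr0.
  apply: ltr_wpDl; first by rewrite mulr_ge0 ?subr_ge0// ltW.
  by rewrite mulr_gt0// lt0r l_neq0.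
set S := (1 - l) * lnGamma a + l * lnGamma b.
pose k1 := expR S * (1 - l) / Gamma a; pose k2 := expR S * l / Gamma b.
have pt t : 0 < t ->
    gamma_integrand z t <= k1 * gamma_integrand a t + k2 * gamma_integrand b t.
  exact: gamma_integrand_convex.
rewrite -ler_expR lnK ?posrE ?Gamma_gt0//.
have -> : expR S = k1 * Gamma a + k2 * Gamma b.
  rewrite /k1 /k2 (divfK (lt0r_neq0 A0)) (divfK (lt0r_neq0 B0)).
  by rewrite -mulrDr subrK mulr1.
rewrite /Gamma -!RintegralZl//; try exact: integrable_gamma_integrand.
have Iz (k c : R) : 0 < c ->
    mu.-integrable `](0 : R), +oo[ (EFin \o (fun t => k * gamma_integrand c t)).
  move=> c0; have mI : measurable (`](0 : R), +oo[%classic : set R) by [].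
  exact: (@integrableZl _ _ _ mu _ mI k _ (integrable_gamma_integrand _ c0)).
rewrite -RintegralD//; [|exact: Iz..].
apply: le_Rintegral => //.
- exact: integrable_gamma_integrand.
- have mI : measurable (`](0 : R), +oo[%classic : set R) by [].
  exact: (@integrableD _ _ _ mu _ mI _ _ (Iz k1 _ a0) (Iz k2 _ b0)).
- by move=> t; rewrite /= in_itv/= andbT => /pt.
Qed.

End gamma_integral.

(** Locked copies of [Gamma] and [lnGamma]. Below, Gamma is used only through
    the properties of the next section; locking keeps the conversion tests of
    the arithmetic tactics from unfolding the integral. *)
HB.lock Definition gam {R : realType} (x : R) : R := Gamma x.
HB.lock Definition lgam {R : realType} (x : R) : R := lnGamma x.

Section locked_gamma.
Context {R : realType}.
Implicit Types (x l a b z : R).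

Lemma gam_gt0 x : 0 < x -> 0 < gam x.
Proof. by rewrite gam.unlock; exact: Gamma_gt0. Qed.

Lemma expR_lgam x : 0 < x -> expR (lgam x) = gam x.
Proof.
by move=> x0; rewrite lgam.unlock gam.unlock /lnGamma lnK// posrE Gamma_gt0.
Qed.

Lemma gamD1 x : 0 < x -> gam (x + 1) = x * gam x.
Proof. by rewrite gam.unlock; exact: GammaD1. Qed.

Lemma lgamD1 z : 0 < z -> lgam (z + 1) = lgam z + ln z.
Proof.
move=> z0; have G0 := Gamma_gt0 _ z0.
by rewrite lgam.unlock /lnGamma GammaD1// lnM ?posrE// addrC.
Qed.

Lemma lgam_convex l a b : 0 < a -> 0 < b -> 0 <= l <= 1 ->
  lgam ((1 - l) * a + l * b) <= (1 - l) * lgam a + l * lgam b.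
Proof. by rewrite lgam.unlock; exact: lnGamma_convex. Qed.

Lemma Gamma_gam x : Gamma x = gam x.
Proof. by rewrite gam.unlock. Qed.

Lemma lnGamma_lgam x : lnGamma x = lgam x.
Proof. by rewrite lgam.unlock. Qed.

End locked_gamma.

(** * Increments of ln Gamma, and continuity *)

Section log_gamma.
Context {R : realType}.
Implicit Types (a b c d e z w : R).
Local Notation L := (@lgam R).

(** Convexity with denominators cleared, the form linear arithmetic can use. *)
Lemma lgam_chord a b c : 0 < a -> a < b -> b < c ->
  (c - a) * L b <= (c - b) * L a + (b - a) * L c.
Proof.
move=> a0 ab bc; have ac0 : 0 < c - a by lra.
have c0 : 0 < c by lra.
pose l := (b - a) / (c - a).
have l01 : 0 <= l <= 1.
  by rewrite /l divr_ge0 ?ler_pdivrMr//=; lra.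
have lE : l * (c - a) = b - a by rewrite /l divfK// gt_eqF.
have h := lgam_convex _ _ _ a0 c0 l01.
have bE : (1 - l) * a + l * c = b.
  by rewrite (_ : _ + _ = a + l * (c - a)); [rewrite lE|]; ring.
rewrite bE in h.
have -> : (c - b) * L a + (b - a) * L c = (c - a) * ((1 - l) * L a + l * L c).
  have -> : (c - a) * ((1 - l) * L a + l * L c)
      = (c - a - l * (c - a)) * L a + l * (c - a) * L c by ring.
  by rewrite lE; ring.
by rewrite ler_pM2l.
Qed.

(** The slope on [a, b] is at most the slope on [b, b + 1], which is ln b. *)
Lemma lgam_incr_le a b : 0 < a -> a < b -> L b - L a <= (b - a) * ln b.
Proof.
move=> a0 ab; have b0 : 0 < b by lra.
have bb1 : b < b + 1 by lra.
have := lgam_chord _ _ _ a0 ab bb1; rewrite lgamD1//; lra.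
Qed.

(** The slope on [a, b] is at least the slope on [a - 1, a], which is
    ln (a - 1). *)
Lemma lgam_incr_ge a b : 1 < a -> a < b -> (b - a) * ln (a - 1) <= L b - L a.
Proof.
move=> a1 ab; have a0 : 0 < a - 1 by lra.
have aa1 : a - 1 < a by lra.
have := lgam_chord _ _ _ a0 aa1 ab.
have := lgamD1 _ a0; rewrite subrK => ->; lra.
Qed.

(** The lower slope estimate needs points above 1, so the Lipschitz bound is
    obtained at z + 1 and brought back to z by the functional equation. *)
Lemma lgam_continuous z : 0 < z -> {for z, continuous L}.
Proof.
move=> z0.
pose K := `|ln (z / 2)| + `|ln (z + 2)| + 1.
have K0 : 0 < K.
  have := normr_ge0 (ln (z / 2)); have := normr_ge0 (ln (z + 2)).
  by rewrite /K; lra.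
have lip w : `|z - w| < Num.min (z / 2) 1 ->
    `|L (z + 1) - L (w + 1)| <= K * `|z - w|.
  rewrite lt_min => /andP[]; rewrite !ltr_distlC => /andP[w1 w2] /andP[w3 w4].
  have slope a b : z / 2 < a -> a < b -> b < z + 1 ->
      `|L (b + 1) - L (a + 1)| <= K * (b - a).
    move=> az ab bz.
    have a1 : 1 < a + 1 by lra.
    have ab1 : a + 1 < b + 1 by lra.
    have a10 : 0 < a + 1 by lra.
    have h1 := lgam_incr_le _ _ a10 ab1.
    have h2 := lgam_incr_ge _ _ a1 ab1.
    rewrite addrK in h2.
    have lb : ln (b + 1) <= K.
      apply: (@le_trans _ _ (ln (z + 2))); first by rewrite ler_ln ?posrE; lra.
      have := ler_norm (ln (z + 2)); have := normr_ge0 (ln (z / 2)).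
      rewrite /K; lra.
    have la : - K <= ln a.
      apply: (@le_trans _ _ (ln (z / 2))); last by rewrite ler_ln ?posrE; lra.
      have := ler_norm (- ln (z / 2)); rewrite normrN.
      have := normr_ge0 (ln (z + 2)); rewrite /K; lra.
    have ba0 : 0 <= b - a by lra.
    have := ler_wpM2l ba0 lb; have := ler_wpM2l ba0 la.
    rewrite ler_norml; lra.
  have [zw|wz|->] := ltgtP z w.
  - by rewrite distrC (distrC z) (gtr0_norm (_ : 0 < w - z)) ?slope; lra.
  - by rewrite (gtr0_norm (_ : 0 < z - w)) ?slope; lra.
  - by rewrite !subrr normr0 mulr0.
have cM : (fun w => L (w + 1)) w @[w --> z] --> L (z + 1).
  apply/cvgrPdist_lt => eps eps0; near=> w.
  apply: (@le_lt_trans _ _ (K * `|z - w|)).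
    apply: lip; near: w; apply: cvgr_dist_lt => //.
    by rewrite lt_min ltr01 andbT divr_gt0.
  rewrite -ltr_pdivlMl//; near: w; apply: cvgr_dist_lt => //.
  by rewrite mulr_gt0// invr_gt0.
have cS : (fun w => L (w + 1) - ln w) w @[w --> z] --> L z.
  have -> : L z = L (z + 1) - ln z by rewrite lgamD1// addrK.
  by apply: cvgB => //; exact: continuous_ln.
apply: cvg_trans cS; apply: near_eq_cvg; near=> w.
have w0 : 0 < w by near: w; exact: lt_nbhsr.
by rewrite lgamD1// addrK.
Unshelve. all: by end_near. Qed.

Lemma gam_continuous z : 0 < z -> {for z, continuous (@gam R)}.
Proof.
move=> z0.
have h : {for z, continuous (expR \o L)}.
  by apply: continuous_comp; [exact: lgam_continuous | exact: continuous_expR].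
have hG : (expR \o L) w @[w --> z] --> gam z by rewrite -expR_lgam.
apply: cvg_trans hG; apply: near_eq_cvg; near=> w.
have w0 : 0 < w by near: w; exact: lt_nbhsr.
by rewrite /= expR_lgam.
Unshelve. all: by end_near. Qed.

End log_gamma.

(** * Mixed second differences of ln Gamma decrease *)

Section mixed_differences.
Context {R : realType}.
Implicit Types (d e z w : R).
Local Notation L := (@lgam R).

Definition mixed_diff d e z : R :=
  L (z + d + e) - L (z + d) - L (z + e) + L z.

(** The drop of [mixed_diff d e] between z and z + 1: by the functional
    equation it is ln ((z + d) (z + e) / (z (z + d + e))). *)
Definition mixed_step d e z : R := ln (1 + d * e / (z * (z + d + e))).

Lemma mixed_diff_ge0 d e (d0 : 0 < d) (e0 : 0 < e) z :
  0 < z -> 0 <= mixed_diff d e z.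
Proof.
move=> z0.
have zd : z < z + d by lra.
have zde : z + d < z + d + e by lra.
have ze : z < z + e by lra.
have zed : z + e < z + d + e by lra.
have h1 := lgam_chord _ _ _ z0 zd zde.
have h2 := lgam_chord _ _ _ z0 ze zed.
rewrite /mixed_diff -(pmulr_rge0 _ (_ : 0 < d + e)); lra.
Qed.

(** Both increments of length e have slope between ln (z - 1) and
    ln (z + d + e), whose difference is O(1/z). *)
Lemma mixed_diff_le d e (d0 : 0 < d) (e0 : 0 < e) z :
  1 < z -> mixed_diff d e z <= e * (d + e + 1) / (z - 1).
Proof.
move=> z1.
have zd0 : 0 < z + d by lra.
have zde : z + d < z + d + e by lra.
have ze : z < z + e by lra.
have h1 := lgam_incr_le _ _ zd0 zde.
have h2 := lgam_incr_ge _ _ z1 ze.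
have z10 : 0 < z - 1 by lra.
have h3 : ln (z + d + e) - ln (z - 1) <= (d + e + 1) / (z - 1).
  rewrite -ln_div ?posrE//; last by lra.
  have -> : (z + d + e) / (z - 1) = 1 + (d + e + 1) / (z - 1).
    by field; rewrite gt_eqF.
  by apply: le_ln1Dx; apply: (@lt_le_trans _ _ 0); rewrite ?divr_ge0; lra.
have h4 := ler_wpM2l (ltW e0) h3.
rewrite /mixed_diff -mulrA; lra.
Qed.

Lemma mixed_diffD1 d e (d0 : 0 < d) (e0 : 0 < e) z :
  0 < z -> mixed_diff d e z = mixed_diff d e (z + 1) + mixed_step d e z.
Proof.
move=> z0; have z1 : 0 < z + d by lra.
have z2 : 0 < z + e by lra.
have z3 : 0 < z + d + e by lra.
have E1 : L (z + 1 + d + e) = L (z + d + e) + ln (z + d + e).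
  by have -> : z + 1 + d + e = z + d + e + 1; [ring|exact: lgamD1].
have E2 : L (z + 1 + d) = L (z + d) + ln (z + d).
  by have -> : z + 1 + d = z + d + 1; [ring|exact: lgamD1].
have E3 : L (z + 1 + e) = L (z + e) + ln (z + e).
  by have -> : z + 1 + e = z + e + 1; [ring|exact: lgamD1].
have E4 : mixed_step d e z = ln (z + d) + ln (z + e) - (ln z + ln (z + d + e)).
  rewrite -!lnM ?posrE// -ln_div ?posrE ?mulr_gt0// /mixed_step.
  by congr ln; field; rewrite !gt_eqF.
by rewrite E4 /mixed_diff E1 E2 E3 lgamD1//; ring.
Qed.

Lemma mixed_step_decr d e (d0 : 0 < d) (e0 : 0 < e) z w :
  0 < z -> z < w -> mixed_step d e w < mixed_step d e z.
Proof.
move=> z0 zw; have w0 : 0 < w by lra.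
have de0 : 0 < d * e by rewrite mulr_gt0.
have zz : 0 < z * (z + d + e) by rewrite mulr_gt0//; lra.
have ww : 0 < w * (w + d + e) by rewrite mulr_gt0//; lra.
have hz : 0 < d * e / (z * (z + d + e)) by rewrite divr_gt0.
have hw : 0 < d * e / (w * (w + d + e)) by rewrite divr_gt0.
rewrite /mixed_step ltr_ln ?posrE; try lra.
rewrite ltrD2l ltr_pM2l// ltf_pV2 ?posrE//.
by apply: ltr_pM => //; lra.
Qed.

(** Moving z and w together by 1 can only increase D w - D z, where
    D = [mixed_diff d e], because the steps decrease. A positive value would
    therefore persist at z + N and w + N, although D tends to 0 there. *)
Lemma mixed_diff_nincr d e (d0 : 0 < d) (e0 : 0 < e) z w :
  0 < z -> z < w -> mixed_diff d e w <= mixed_diff d e z.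
Proof.
move=> z0 zw.
have stepN N : mixed_diff d e w - mixed_diff d e z <=
    mixed_diff d e (w + N%:R) - mixed_diff d e (z + N%:R).
  elim: N => [|N IH]; first by rewrite !addr0.
  apply: (le_trans IH).
  have zN : 0 < z + N%:R by rewrite ltr_pwDl.
  have zwN : z + N%:R < w + N%:R by lra.
  have wN : 0 < w + N%:R by lra.
  have := mixed_step_decr _ _ d0 e0 _ _ zN zwN.
  have := mixed_diffD1 _ _ d0 e0 _ zN; have := mixed_diffD1 _ _ d0 e0 _ wN.
  have -> : w + N%:R + 1 = w + N.+1%:R by rewrite -natr1 addrA.
  have -> : z + N%:R + 1 = z + N.+1%:R by rewrite -natr1 addrA.
  lra.
rewrite leNgt; apply/negP => lt.
pose eps := mixed_diff d e w - mixed_diff d e z.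
have eps0 : 0 < eps by rewrite subr_gt0.
pose B := e * (d + e + 1).
have B0 : 0 < B by rewrite mulr_gt0//; lra.
(* N is chosen so that the bound B / (w + N - 1) on D (w + N) is below eps *)
pose N := (Num.truncn (B / eps)).+2.
have hN : B / eps + 1 < N%:R.
  by rewrite /N -natr1 ltrD2r; exact: truncnS_gt.
have Be0 : 0 < B / eps by rewrite divr_gt0.
have wN : 1 < w + N%:R by lra.
have zN : 0 < z + N%:R by lra.
have h1 : mixed_diff d e (w + N%:R) <= B / (w + N%:R - 1).
  exact: mixed_diff_le.
have h2 := mixed_diff_ge0 _ _ d0 e0 _ zN.
have h3 : B / (w + N%:R - 1) < eps.
  rewrite ltr_pdivrMr; last by lra.
  by rewrite mulrC -ltr_pdivrMr//; lra.
have h4 : eps <= mixed_diff d e (w + N%:R) - mixed_diff d e (z + N%:R).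
  exact: stepN.
lra.
Qed.

(** One step gives a strict loss; from z + 1 on, monotonicity suffices. *)
Lemma mixed_diff_decr d e (d0 : 0 < d) (e0 : 0 < e) z w :
  0 < z -> z < w -> mixed_diff d e w < mixed_diff d e z.
Proof.
move=> z0 zw; have w0 : 0 < w by lra.
have z10 : 0 < z + 1 by lra.
have zw1 : z + 1 < w + 1 by lra.
have := mixed_diff_nincr _ _ d0 e0 _ _ z10 zw1.
have := mixed_step_decr _ _ d0 e0 _ _ z0 zw.
rewrite (mixed_diffD1 _ _ d0 e0 _ z0) (mixed_diffD1 _ _ d0 e0 _ w0); lra.
Qed.

End mixed_differences.

(** * The even profile F and its root *)

Section profile.
Context {R : realType}.
Implicit Types (x y v w s z : R).
Local Notation L := (@lgam R).

Definition gamma_pair x v : R :=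
  L (x + 1 / 2 + v) + L (x + 1 / 2 - v) - 2 * L x.

(** The function f_{n,s}(a) in the variable v = a sqrt(n) / 2, with
    x = n/4 + s/2 and y = n/4 - s/2. *)
Definition profile x y v : R := gamma_pair x v - gamma_pair y v.

Lemma gamma_pairN x v : gamma_pair x (- v) = gamma_pair x v.
Proof. by rewrite /gamma_pair opprK; ring. Qed.

Lemma profileN x y v : profile x y (- v) = profile x y v.
Proof. by rewrite /profile !gamma_pairN. Qed.

(** The points x + 1/2 -+ w and x + 1/2 -+ v are the four vertices of a mixed
    difference with steps w - v and w + v based at x + 1/2 - w. *)
Lemma mixed_diff_gamma_pair x v w :
  mixed_diff (w - v) (w + v) (x + 1 / 2 - w) = gamma_pair x w - gamma_pair x v.
Proof.
rewrite /mixed_diff /gamma_pair.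
have -> : x + 1 / 2 - w + (w - v) + (w + v) = x + 1 / 2 + w by ring.
have -> : x + 1 / 2 - w + (w - v) = x + 1 / 2 - v by ring.
have -> : x + 1 / 2 - w + (w + v) = x + 1 / 2 + v by ring.
ring.
Qed.

(** Going from v to w changes F by a mixed difference based at
    x + 1/2 - w minus the same one based at the smaller point y + 1/2 - w. *)
Lemma profile_decr x y v w :
  0 < y -> y < x -> 0 <= v -> v < w -> w < y + 1 / 2 ->
  profile x y w < profile x y v.
Proof.
move=> y0 yx v0 vw wy.
have d0 : 0 < w - v by lra.
have e0 : 0 < w + v by lra.
have yw0 : 0 < y + 1 / 2 - w by lra.
have yxw : y + 1 / 2 - w < x + 1 / 2 - w by lra.
have := mixed_diff_decr _ _ d0 e0 _ _ yw0 yxw.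
by rewrite !mixed_diff_gamma_pair /profile; lra.
Qed.

Lemma gamma_pair_half x : 0 < x -> gamma_pair x (1 / 2) = ln x.
Proof.
move=> x0; rewrite /gamma_pair (_ : x + 1 / 2 + 1 / 2 = x + 1); last by field.
by rewrite addrK lgamD1//; ring.
Qed.

Lemma profile_half_gt0 x y : 0 < y -> y < x -> 0 < profile x y (1 / 2).
Proof.
move=> y0 yx; have x0 : 0 < x by lra.
by rewrite /profile !gamma_pair_half// subr_gt0 ltr_ln.
Qed.

Lemma expR_gamma_pair x v : 0 < x -> - (x + 1 / 2) < v < x + 1 / 2 ->
  expR (gamma_pair x v) =
  gam (x + 1 / 2 + v) * gam (x + 1 / 2 - v) / gam x ^+ 2.
Proof.
move=> x0 /andP[v1 v2].
have h1 : 0 < x + 1 / 2 + v by lra.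
have h2 : 0 < x + 1 / 2 - v by lra.
rewrite /gamma_pair expRB expRD expRM_natl.
by rewrite (expR_lgam _ h1) (expR_lgam _ h2) (expR_lgam _ x0).
Qed.

Lemma profile_gt0E x y v : 0 < y -> y < x -> - (y + 1 / 2) < v < y + 1 / 2 ->
  (0 < profile x y v) =
  (gam x ^+ 2 / gam y ^+ 2 <
   gam (x + 1 / 2 + v) * gam (x + 1 / 2 - v) /
   (gam (y + 1 / 2 + v) * gam (y + 1 / 2 - v))).
Proof.
move=> y0 yx /andP[v1 v2]; have x0 : 0 < x by lra.
rewrite /profile subr_gt0 -[gamma_pair y v < _]ltr_expR.
have vy : - (y + 1 / 2) < v < y + 1 / 2 by lra.
have vx : - (x + 1 / 2) < v < x + 1 / 2 by lra.
rewrite (expR_gamma_pair _ _ x0 vx) (expR_gamma_pair _ _ y0 vy).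
have Gx := gam_gt0 _ x0; have Gy := gam_gt0 _ y0.
have y1 : 0 < y + 1 / 2 + v by lra.
have y2 : 0 < y + 1 / 2 - v by lra.
have Gy1 := gam_gt0 _ y1; have Gy2 := gam_gt0 _ y2.
rewrite ltr_pdivrMr ?exprn_gt0// [in RHS]ltr_pdivlMr ?mulr_gt0//.
rewrite [in RHS]mulrAC [in RHS]ltr_pdivrMr ?exprn_gt0//.
rewrite [in LHS]mulrAC [in LHS]ltr_pdivlMr ?exprn_gt0//.
by rewrite [in LHS]mulrC.
Qed.

(** F tends to -oo at y + 1/2. Multiplying through by the Gamma factors and by
    y + 1/2 - v, which cancels the pole of Gamma(y + 1/2 - v), gives a
    continuous function H on the closed interval with the sign of F inside and
    H(y + 1/2) < 0, to which the intermediate value theorem applies. *)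
Lemma profile_root x y : 0 < y -> y < x ->
  exists2 v, 1 / 2 < v < y + 1 / 2 & profile x y v = 0.
Proof.
move=> y0 yx; have x0 : 0 < x by lra.
have Gx := gam_gt0 _ x0; have Gy := gam_gt0 _ y0.
pose H v := gam (x + 1 / 2 + v) * gam (x + 1 / 2 - v) * gam y ^+ 2
    * (y + 1 / 2 - v)
  - gam x ^+ 2 * gam (y + 1 / 2 + v) * gam (y + 3 / 2 - v).
have HE v : 0 <= v < y + 1 / 2 -> H v = gam y ^+ 2 * gam x ^+ 2
     * (y + 1 / 2 - v) * (expR (gamma_pair x v) - expR (gamma_pair y v)).
  move=> /andP[v0 vy].
  have vx : - (x + 1 / 2) < v < x + 1 / 2 by clear - x0 yx v0 vy; lra.
  have vy' : - (y + 1 / 2) < v < y + 1 / 2 by clear - y0 v0 vy; lra.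
  have yv0 : 0 < y + 1 / 2 - v by clear - vy; lra.
  rewrite (expR_gamma_pair _ _ x0 vx) (expR_gamma_pair _ _ y0 vy').
  have -> : H v = gam (x + 1 / 2 + v) * gam (x + 1 / 2 - v) * gam y ^+ 2
      * (y + 1 / 2 - v) - gam x ^+ 2 * gam (y + 1 / 2 + v)
        * ((y + 1 / 2 - v) * gam (y + 1 / 2 - v)).
    rewrite /H (_ : y + 3 / 2 - v = y + 1 / 2 - v + 1); last by field.
    by rewrite gamD1.
    by field; rewrite !gt_eqF.
have cH : {within `[1 / 2, y + 1 / 2], continuous H}.
  apply: continuous_in_subspaceT => v; rewrite inE/= in_itv/= => /andP[v1 v2].
  have cG c : 0 < c + v -> {for v, continuous (fun v => gam (c + v))}.
    move=> h; apply: (@continuous_comp _ _ _ (fun v => c + v) (@gam R)).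
      by apply: cvgD; [exact: cvg_cst|exact: cvg_id].
    exact: gam_continuous.
  have cGN c : 0 < c - v -> {for v, continuous (fun v => gam (c - v))}.
    move=> h; apply: (@continuous_comp _ _ _ (fun v => c - v) (@gam R)).
      by apply: cvgB; [exact: cvg_cst|exact: cvg_id].
    exact: gam_continuous.
  have c1 : {for v, continuous (fun v => gam (x + 1 / 2 + v))}.
    by apply: cG; clear - v1 x0; lra.
  have c2 : {for v, continuous (fun v => gam (x + 1 / 2 - v))}.
    by apply: cGN; clear - v2 yx; lra.
  have c3 : {for v, continuous (fun v => gam (y + 1 / 2 + v))}.
    by apply: cG; clear - v1 y0; lra.
  have c4 : {for v, continuous (fun v => gam (y + 3 / 2 - v))}.
    by apply: cGN; clear - v2 y0; lra.
  have c5 : {for v, continuous (fun v => y + 1 / 2 - v)}.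
    by apply: cvgB; [exact: cvg_cst|exact: cvg_id].
  exact: (cvgB (cvgM (cvgM (cvgM c1 c2) (cvg_cst (gam y ^+ 2))) c5)
    (cvgM (cvgM (cvg_cst (gam x ^+ 2)) c3) c4)).
have H1 : 0 < H (1 / 2).
  rewrite HE; last by clear - y0; lra.
  rewrite mulr_gt0//.
    by rewrite !mulr_gt0// ?exprn_gt0//; clear - y0; lra.
  by rewrite subr_gt0 ltr_expR -subr_gt0; exact: profile_half_gt0.
have H2 : H (y + 1 / 2) < 0.
  rewrite /H subrr mulr0 sub0r oppr_lt0 !mulr_gt0// ?exprn_gt0//;
    by apply: gam_gt0; clear - y0; lra.
have h12 : 1 / 2 <= y + 1 / 2 by clear - y0; lra.
have h0 : Num.min (H (1 / 2)) (H (y + 1 / 2)) <= 0 <=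
    Num.max (H (1 / 2)) (H (y + 1 / 2)).
  by rewrite ge_min le_max (ltW H1) (ltW H2) orbT.
have [v] := IVT h12 cH h0.
rewrite in_itv/= => /andP[v1 v2] Hv.
have v1' : 1 / 2 < v.
  by rewrite lt_neqAle v1 andbT; apply/eqP => h; move: H1; rewrite h Hv ltxx.
have v2' : v < y + 1 / 2.
  by rewrite lt_neqAle v2 andbT; apply/eqP => h; move: H2; rewrite -h Hv ltxx.
exists v; first by rewrite v1'.
move/eqP: Hv; rewrite HE; last by clear - v1' v2'; lra.
rewrite mulf_eq0 gt_eqF/=; last first.
  by rewrite !mulr_gt0// ?exprn_gt0//; clear - v2'; lra.
by rewrite subr_eq0 => /eqP/expR_inj h; rewrite /profile h subrr.
Qed.

Lemma profile_gt0P x y v w : 0 < y -> y < x ->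
  0 < v < y + 1 / 2 -> profile x y v = 0 -> - (y + 1 / 2) < w < y + 1 / 2 ->
  (0 < profile x y w) = (- v < w < v).
Proof.
move=> y0 yx /andP[v0 vy] Fv /andP[wl wr].
wlog w0 : w wl wr / 0 <= w => [hw|].
  have [w0|w0] := leP 0 w; first exact: hw.
  have hl : - (y + 1 / 2) < - w by lra.
  have hr : - w < y + 1 / 2 by lra.
  have hp : 0 <= - w by lra.
  by rewrite -profileN (hw _ hl hr hp) ltrN2 ltrNl andbC.
have -> /= : - v < w by clear - v0 w0; lra.
apply/idP/idP => [|wv].
  apply: contraTT; rewrite -!leNgt le_eqVlt => /predU1P[<-|vw].
    by rewrite Fv.
  by rewrite -Fv ltW// profile_decr// ltW.
by rewrite -Fv profile_decr.
Qed.

(** * The value of F as p tends to infinity *)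

(** When p tends to infinity, t = s / (p - 1) tends to 0 and v to 1/2 - y; F is
    even. *)
Definition profile_infty s y : R := profile (y + s) y (y - 1 / 2).

Lemma profile_inftyE s y : profile_infty s y =
  L (y + y + s) - L (y + y) - 2 * (L (y + s) - L y) + (L (s + 1) - L 1).
Proof.
rewrite /profile_infty /profile /gamma_pair.
have -> : y + s + 1 / 2 + (y - 1 / 2) = y + y + s by ring.
have -> : y + s + 1 / 2 - (y - 1 / 2) = s + 1 by field.
have -> : y + 1 / 2 + (y - 1 / 2) = y + y by ring.
have -> : y + 1 / 2 - (y - 1 / 2) = 1 by field.
ring.
Qed.

(** With h(u) = L(u + s) - L(u), the value is h(2y) - 2 h(y) plus a constant.
    Passing from y to z moves the argument of h(2y) from y + y to y + z and then
    to z + z: two increments of length z - y, based to the right of y, hence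
    each smaller than h(z) - h(y) by the decrease of mixed differences. *)
Lemma profile_infty_decr s y z : 0 < s -> 0 < y -> y < z ->
  profile_infty s z < profile_infty s y.
Proof.
move=> s0 y0 yz; have d0 : 0 < z - y by lra.
have yy : y < y + y by lra.
have yzy : y < y + z by lra.
have h1 := mixed_diff_decr _ _ d0 s0 _ _ y0 yy.
have h2 := mixed_diff_decr _ _ d0 s0 _ _ y0 yzy.
rewrite /mixed_diff in h1 h2.
rewrite (_ : y + y + (z - y) = y + z) in h1; last by ring.
rewrite (_ : y + z + (z - y) = z + z) in h2; last by ring.
rewrite (_ : y + (z - y) = z) in h1 h2; last by ring.
rewrite !profile_inftyE; lra.
Qed.

(** The value at y = 1 is ln (1 + s). *)
Lemma profile_infty1_gt0 s : 0 < s -> 0 < profile_infty s 1.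
Proof.
move=> s0; have s1 : 0 < 1 + s by lra.
rewrite profile_inftyE (addrAC 1 1 s) (addrC s 1) !lgamD1// ln1.
have : 0 < ln (1 + s) by apply: ln_gt0; lra.
lra.
Qed.

(** With h as above, h(2y) <= s ln (2y + s) and h(y) >= s ln (y - 1), so the
    value is at most s ln ((2y + s) / (y - 1)^2) plus a constant. *)
Lemma profile_infty_eventually_lt0 s : 0 < s ->
  exists2 M, 0 < M & forall y, M < y -> profile_infty s y < 0.
Proof.
move=> s0; pose c := L (s + 1) - L 1.
have E0 : 0 < expR (c / s) by exact: expR_gt0.
have cE : c / s = ln (expR (c / s)) by rewrite expRK.
have scE : s * (c / s) = c by rewrite mulrC divfK// gt_eqF.
have M0 : 0 < 2 + s + 4 * expR (c / s) by lra.
(* 2 + s gives 2y + s <= 4 (y - 1); the rest gives 4 exp(c/s) < y - 1 *)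
exists (2 + s + 4 * expR (c / s)) => // y yM.
have y1 : 1 < y by lra.
have ys1 : y + y + s <= 4 * (y - 1) by lra.
have yE : 4 * expR (c / s) < y - 1 by lra.
have y0 : 0 < y by clear - y1; lra.
have yy0 : 0 < y + y by clear - y1; lra.
have yys : y + y < y + y + s by clear - s0; lra.
have yys0 : 0 < y + y + s by clear - s0 yy0; lra.
have ys : y < y + s by clear - s0; lra.
have y10 : 0 < y - 1 by clear - y1; lra.
have h1 := lgam_incr_le _ _ yy0 yys.
have h2 := lgam_incr_ge _ _ y1 ys.
have h3 : ln (y + y + s) + c / s < ln (y - 1) + ln (y - 1).
  rewrite cE -!lnM ?posrE// ltr_ln ?posrE ?mulr_gt0//.
  apply: (@le_lt_trans _ _ (4 * expR (c / s) * (y - 1))).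
    by rewrite mulrAC ler_pM2r.
  by rewrite ltr_pM2r.
have h4 : s * ln (y + y + s) + c < s * (ln (y - 1) + ln (y - 1)).
  by rewrite -{1}scE -mulrDr ltr_pM2l.
rewrite profile_inftyE -/c; lra.
Qed.

End profile.

(** * The inequality in terms of the root, for fixed n and s *)

Section threshold.
Context {R : realType}.
Variables (n : nat) (s : R).
Hypotheses (n_gt0 : (0 < n)%N) (s_gt0 : 0 < s) (sn : 2 * s < n%:R).
Let x : R := n%:R / 4 + s / 2.
Let y : R := n%:R / 4 - s / 2.
Let r : R := Num.sqrt n%:R.

Let r_gt0 : 0 < r.
Proof. by rewrite sqrtr_gt0 ltr0n. Qed.

Let y_gt0 : 0 < y.
Proof. by rewrite /y; move: sn; lra. Qed.

Let ltyx : y < x.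
Proof. by rewrite /x /y; move: s_gt0; lra. Qed.

Lemma f_nsE (a : R) : f_ns n s a = profile x y (1 / 2 * a * r).
Proof. by rewrite /f_ns !lnGamma_lgam /profile /gamma_pair /x /y /r; ring. Qed.

Lemma f_domE (a : R) :
  f_dom n s a <-> - (y + 1 / 2) < 1 / 2 * a * r < y + 1 / 2.
Proof.
have h2 : 0 < 1 / 2 * r by move: r_gt0; lra.
have E : y + 1 / 2 =
    1 / 2 * r * (2^-1 * ((n%:R - 2 * s) / r) + 1 / r).
  by rewrite /y; field; rewrite gt_eqF.
rewrite E (_ : 1 / 2 * a * r = 1 / 2 * r * a); last by ring.
by rewrite -mulrN !ltr_pM2l// opprD.
Qed.

(** The root v of F is a_{n,s} sqrt(n) / 2; the last conjunct has the shape in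
    which a_{n,s} enters p1 and p2. *)
Lemma a_nsP : exists v, [/\ 1 / 2 < v < y + 1 / 2, profile x y v = 0
  & 2 * a_ns n s * r = 4 * v].
Proof.
have [v /andP[v1 v2] Fv] := profile_root _ _ y_gt0 ltyx.
have v0 : 0 < v by lra.
exists v; split => //; first by rewrite v1.
have r0 := r_gt0.
have root_v b : pos_root n s b -> 1 / 2 * b * r = v.
  move=> [/f_domE/andP[_ b2] b0]; rewrite f_nsE => Fb.
  set w := 1 / 2 * b * r in b2 Fb *.
  have w0 : 0 < w by rewrite /w !mulr_gt0.
  have [wv|vw|//] := ltgtP w v.
  - have := profile_decr _ _ _ _ y_gt0 ltyx (ltW w0) wv v2.
    by rewrite Fv Fb ltxx.
  - have := profile_decr _ _ _ _ y_gt0 ltyx (ltW v0) vw b2.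
    by rewrite Fv Fb ltxx.
pose a := 2 * v / r.
have aE : 1 / 2 * a * r = v by rewrite /a; field; rewrite gt_eqF.
have ra : pos_root n s a.
  split; [apply/f_domE; rewrite aE; lra| |by rewrite f_nsE aE].
  by rewrite /a divr_gt0// mulr_gt0.
have unq b : pos_root n s b -> b = a.
  move=> /root_v; rewrite -aE => /(mulIf (lt0r_neq0 r0)).
  by move=> /mulfI; apply; lra.
have -> : a_ns n s = a.
  apply: xget_unique; first by split=> // b /unq.
  by move=> b [/unq].
by rewrite -aE; field.
Qed.

Section exponent.
Variable p : R.
Hypothesis hp : n%:R / (n%:R - 2 * s) < p.

Let n2s_gt0 : 0 < n%:R - 2 * s. Proof. by rewrite subr_gt0. Qed.

Let p1_gt0 : 0 < p - 1.
Proof.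
move: hp; rewrite ltr_pdivrMr// => h.
have := s_gt0; have := n2s_gt0; nra.
Qed.

Let t : R := s / (p - 1).

Lemma dual_exponent_gt0 : 0 < t.
Proof. exact: divr_gt0. Qed.

Let t_lt : t < 2 * y.
Proof.
rewrite /t ltr_pdivrMr//; move: hp; rewrite ltr_pdivrMr// /y; lra.
Qed.

(** The factor p = (s + t) / t turns Gamma(s + t) / Gamma(t) into
    Gamma(s + t + 1) / Gamma(t + 1); the four arguments are then
    x + 1/2 + v, x + 1/2 - v, y + 1/2 + v, y + 1/2 - v at v = t - y + 1/2. *)
Lemma ineq_IE : ineq_I n s p <-> 0 < profile x y (t - y + 1 / 2).
Proof.
have t0 := dual_exponent_gt0; have t2 := t_lt; have s0 := s_gt0.
have vy : - (y + 1 / 2) < t - y + 1 / 2 < y + 1 / 2 by lra.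
rewrite (profile_gt0E _ _ _ y_gt0 ltyx vy) /ineq_I !Gamma_gam -/t.
have -> : (n%:R + 2 * s) / 4 = x by rewrite /x; field.
have -> : (n%:R - 2 * s) / 4 = y by rewrite /y; field.
have -> : x + 1 / 2 + (t - y + 1 / 2) = s + t + 1 by rewrite /x /y; field.
have -> : y + 1 / 2 + (t - y + 1 / 2) = t + 1 by field.
have -> : x + 1 / 2 - (t - y + 1 / 2) = n%:R / 2 - t by rewrite /x /y; field.
have -> : y + 1 / 2 - (t - y + 1 / 2) = (n%:R - 2 * s) / 2 - t.
  by rewrite /y; field.
have st0 : 0 < s + t by lra.
have ty0 : 0 < (n%:R - 2 * s) / 2 - t by move: t2; rewrite /y; lra.
rewrite !gamD1//.
have G1 := gam_gt0 _ t0; have G2 := gam_gt0 _ ty0.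
suff -> : p = (s + t) / t.
  suff -> : (s + t) / t * (gam (n%:R / 2 - t) * gam (s + t) /
      (gam t * gam ((n%:R - 2 * s) / 2 - t))) =
    (s + t) * gam (s + t) * gam (n%:R / 2 - t) /
      (t * gam t * gam ((n%:R - 2 * s) / 2 - t)) by [].
  by field; rewrite !gt_eqF.
rewrite /t; have := p1_gt0; have := s_gt0 => s1 p1.
by field; rewrite !gt_eqF.
Qed.

(** The map c |-> (c + s) / c inverts p |-> s / (p - 1) and reverses order;
    p1 and p2 are its values at y - 1/2 + v and y - 1/2 - v. *)
Lemma ltr_shift_ratio c : 0 < c -> ((c + s) / c < p) = (t < c).
Proof.
move=> c0; have P := p1_gt0.
rewrite ltr_pdivrMr// /t ltr_pdivrMr//; apply/idP/idP; lra.
Qed.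

Lemma gtr_shift_ratio c : 0 < c -> (p < (c + s) / c) = (c < t).
Proof.
move=> c0; have P := p1_gt0.
rewrite ltr_pdivlMr// /t ltr_pdivlMr//; apply/idP/idP; lra.
Qed.

Lemma ineq_I_interval v : 1 / 2 < v < y + 1 / 2 -> profile x y v = 0 ->
  ineq_I n s p <-> (y - 1 / 2 - v < t < y - 1 / 2 + v).
Proof.
move=> /andP[v1 v2] Fv; rewrite ineq_IE.
have t0 := dual_exponent_gt0; have t2 := t_lt.
have vy : - (y + 1 / 2) < t - y + 1 / 2 < y + 1 / 2 by lra.
have v0 : 0 < v < y + 1 / 2 by lra.
rewrite (profile_gt0P _ _ _ _ y_gt0 ltyx v0 Fv vy).
by split; lra.
Qed.

End exponent.

Lemma p1E v : 0 < y - 1 / 2 + v -> 2 * a_ns n s * r = 4 * v ->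
  p1 n s = (y - 1 / 2 + v + s) / (y - 1 / 2 + v).
Proof.
move=> c0 av; rewrite /p1 -/r av.
have -> : n%:R + 2 * s - 2 + 4 * v = 4 * (y - 1 / 2 + v + s).
  by rewrite /y; field.
have -> : n%:R - 2 * s - 2 + 4 * v = 4 * (y - 1 / 2 + v) by rewrite /y; field.
by rewrite -mulf_div divff ?mul1r.
Qed.

Lemma p2_denE v : 2 * a_ns n s * r = 4 * v -> p2_den n s = 4 * (y - 1 / 2 - v).
Proof. by move=> av; rewrite /p2_den -/r av /y; field. Qed.

Lemma p2E v : 2 * a_ns n s * r = 4 * v ->
  p2 n s = (y - 1 / 2 - v + s) / (y - 1 / 2 - v).
Proof.
move=> av; rewrite /p2 (p2_denE v av) -/r av.
have -> : n%:R + 2 * s - 2 - 4 * v = 4 * (y - 1 / 2 - v + s).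
  by rewrite /y; field.
by rewrite -mulf_div divff ?mul1r.
Qed.

Let inftyE : profile_infty s y = profile x y (y - 1 / 2).
Proof. by rewrite /profile_infty; congr profile; rewrite /x /y; field. Qed.

(** F >= 0 at y - 1/2 puts the root v at or beyond y - 1/2, so the lower bound
    y - 1/2 - v on t is nonpositive. *)
Lemma ineq_I_one_sided : 0 <= profile_infty s y ->
  forall p : R, n%:R / (n%:R - 2 * s) < p -> (ineq_I n s p <-> p1 n s < p).
Proof.
move=> infty0 p hp; have [v [v12 Fv av]] := a_nsP.
have /andP[v1 v2] := v12; have y0 := y_gt0.
have c0 : 0 < y - 1 / 2 + v by lra.
have yv : y - 1 / 2 <= v.
  rewrite leNgt; apply/negP => vy; have v0 : 0 <= v by lra.
  have yy : y - 1 / 2 < y + 1 / 2 by lra.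
  have := profile_decr _ _ _ _ y0 ltyx v0 vy yy.
  by rewrite Fv -inftyE ltNge infty0.
rewrite (ineq_I_interval p hp v v12 Fv) (p1E v c0 av) (ltr_shift_ratio p hp)//.
have -> : y - 1 / 2 - v < s / (p - 1) by have := dual_exponent_gt0 p hp; lra.
by [].
Qed.

(** F < 0 at y - 1/2 forces y > 1 and v < y - 1/2. The chain of fractions is
    then c |-> (c + s) / c at 2y > y - 1/2 + v > y > y - 1 > y - 1/2 - v > 0,
    as 1/2 < v < y + 1/2. *)
Lemma ineq_I_two_sided : profile_infty s y < 0 ->
  (forall p : R, n%:R / (n%:R - 2 * s) < p ->
     (ineq_I n s p <-> p1 n s < p < p2 n s)) /\
  [/\ n%:R / (n%:R - 2 * s) < p1 n s,
      p1 n s < (n%:R + 2 * s) / (n%:R - 2 * s),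
      (n%:R + 2 * s) / (n%:R - 2 * s)
        < (n%:R + 2 * s - 4) / (n%:R - 2 * s - 4),
      (n%:R + 2 * s - 4) / (n%:R - 2 * s - 4) < p2 n s
    & 0 < p2_den n s].
Proof.
move=> infty0; have [v [v12 Fv av]] := a_nsP.
have /andP[v1 v2] := v12; have y0 := y_gt0; have s0 := s_gt0.
have y1 : 1 < y.
  rewrite ltNge le_eqVlt; apply/negP => /predU1P[yE|ylt].
    have := profile_infty1_gt0 _ s0.
    by rewrite -yE => /(lt_trans infty0); rewrite ltxx.
  have := profile_infty_decr _ _ _ s0 y0 ylt; have := profile_infty1_gt0 _ s0.
  by move: infty0; lra.
have vy : v < y - 1 / 2.
  rewrite ltNge le_eqVlt; apply/negP => /predU1P[yv|yv].
    by move: infty0; rewrite inftyE yv Fv ltxx.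
  have yp : 0 <= y - 1 / 2 by lra.
  have := profile_decr _ _ _ _ y0 ltyx yp yv v2.
  by rewrite Fv -inftyE => /(lt_trans infty0); rewrite ltxx.
have c1 : 0 < y - 1 / 2 + v by lra.
have c2 : 0 < y - 1 / 2 - v by lra.
have ratio a b : 0 < a -> a < b -> (b + s) / b < (a + s) / a.
  move=> a0 ab; have b0 : 0 < b by lra.
  rewrite !mulrDl !divff ?gt_eqF// ltrD2l ltr_pM2l// ltf_pV2 ?posrE//.
split=> [p hp|].
  rewrite (ineq_I_interval p hp v v12 Fv) (p1E v c1 av) (p2E v av).
  by rewrite (ltr_shift_ratio p hp)// (gtr_shift_ratio p hp)// andbC.
have -> : n%:R / (n%:R - 2 * s) = (2 * y + s) / (2 * y).
  have -> : n%:R - 2 * s = 2 * (2 * y) by rewrite /y; field.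
  have -> : n%:R = 2 * (2 * y + s) by rewrite /y; field.
  by rewrite -mulf_div divff ?mul1r.
have -> : (n%:R + 2 * s) / (n%:R - 2 * s) = (y + s) / y.
  have -> : n%:R + 2 * s = 4 * (y + s) by rewrite /y; field.
  have -> : n%:R - 2 * s = 4 * y by rewrite /y; field.
  by rewrite -mulf_div divff ?mul1r.
have -> : (n%:R + 2 * s - 4) / (n%:R - 2 * s - 4) = (y - 1 + s) / (y - 1).
  have -> : n%:R + 2 * s - 4 = 4 * (y - 1 + s) by rewrite /y; field.
  have -> : n%:R - 2 * s - 4 = 4 * (y - 1) by rewrite /y; field.
  by rewrite -mulf_div divff ?mul1r.
rewrite (p1E v c1 av) (p2E v av) (p2_denE v av).
by split; [apply: ratio; lra..|lra].
Qed.

End threshold.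

(** * The dimension threshold *)

(* In the last conjunct, 0 < p2_den n s renders p2 < +oo: division by zero
   yields 0 in the library, so finiteness of p2 is stated on its denominator. *)
Theorem theorem1p2 (R : realType) (s : R) (hs : 0 < s) :
  exists2 n0 : nat, (0 < n0)%N &
    forall n : nat, (0 < n)%N -> 2 * s < n%:R ->
      ((n <= n0)%N ->
         forall p : R, n%:R / (n%:R - 2 * s) < p ->
           (ineq_I n s p <-> p1 n s < p)) /\
      ((n0 < n)%N ->
         (forall p : R, n%:R / (n%:R - 2 * s) < p ->
            (ineq_I n s p <-> p1 n s < p < p2 n s)) /\
         [/\ n%:R / (n%:R - 2 * s) < p1 n s,
             p1 n s < (n%:R + 2 * s) / (n%:R - 2 * s),
             (n%:R + 2 * s) / (n%:R - 2 * s)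
               < (n%:R + 2 * s - 4) / (n%:R - 2 * s - 4),
             (n%:R + 2 * s - 4) / (n%:R - 2 * s - 4) < p2 n s
           & 0 < p2_den n s]).
Proof.
pose y (n : nat) : R := n%:R / 4 - s / 2.
pose P (n : nat) := (2 * s < n%:R) && (profile_infty s (y n) < 0).
have exP : exists n, P n.
  have [M M0 hM] := profile_infty_eventually_lt0 _ hs.
  have := truncnS_gt (4 * M + 2 * s); set N := Num.truncn _ => hN.
  by exists N.+1; rewrite /P hM ?andbT /y; lra.
case: (ex_minnP exP) => m /andP[sm inftym] mmin.
have m1 : (1 < m)%N.
  rewrite ltnNge; apply/negP => m1.
  have y1 : y m < 1.
    have : m%:R <= 1 :> R by rewrite lern1.
    by rewrite /y; lra.
  have ym0 : 0 < y m by rewrite /y; lra.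
  have := profile_infty_decr _ _ _ hs ym0 y1.
  have := profile_infty1_gt0 _ hs; lra.
(* m is the first dimension in the two-sided case, so n0 is its predecessor *)
exists m.-1 => [|n n0 sn]; first by rewrite -ltnS prednK// ltnW.
have m0 : (0 < m)%N by exact: ltnW.
split=> [nm|mn].
  apply: ineq_I_one_sided => //; rewrite leNgt; apply/negP => inftyn.
  have : P n by rewrite /P sn.
  by move/mmin; rewrite leqNgt -(prednK m0) ltnS nm.
apply: ineq_I_two_sided => //.
rewrite prednK// leq_eqVlt in mn.
case/predU1P: mn => [<-//|mn].
apply: lt_trans inftym; apply: profile_infty_decr => //.
  by rewrite /y; lra.
have : m%:R < n%:R :> R by rewrite ltr_nat.
by rewrite /y; lra.
Qed.
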